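(* For the ideal MHD system, the following property, called the Lax–Friedrichs (LF) splitting property, does not hold in general: $$\mathbf U\pm\frac{\mathbf F_i(\mathbf U)}{\alpha}\in\mathcal G,\qquad \forall\,\mathbf U\in\mathcal G,\quad \forall\,\alpha\ge\chi\,\mathscr R_i(\mathbf U),$$ where $\chi\ge1$ is some constant and $\mathscr R_i(\mathbf U)$ is the spectral radius of the Jacobian matrix in the $x_i$-direction, $i=1,2,3$.
   Context: The ideal compressible magnetohydrodynamics (MHD) equations in $d$ dimensions ($d=1,2$ or $3$) are $\partial_t\mathbf U+\sum_{i=1}^d\partial_{x_i}\mathbf F_i(\mathbf U)=\mathbf 0$, with conservative vector $\mathbf U=(\rho,\mathbf m,\mathbf B,E)^\top\in\mathbb R^8$, where $\rho$ is the density, $\mathbf m=\rho\mathbf v$ the momentum, $\mathbf v=(v_1,v_2,v_3)$ the velocity, $\mathbf B=(B_1,B_2,B_3)$ the magnetic field, and $E=\rho e+\frac12(\rho|\mathbf v|^2+|\mathbf B|^2)$ the total energy, $e$ being the specific internal energy. The flux in the $x_i$-direction is $$\mathbf F_i(\mathbf U)=\big(\rho v_i,\ \rho v_i\mathbf v-B_i\mathbf B+p_{tot}\mathbf e_i,\ v_i\mathbf B-B_i\mathbf v,\ v_i(E+p_{tot})-B_i(\mathbf v\cdot\mathbf B)\big)^\top,$$ where $\mathbf e_i$ is the $i$-th row of the $3\times3$ unit matrix and $p_{tot}=p+\frac{|\mathbf B|^2}{2}$ is the total pressure. The gas pressure $p$ is given by an equation of state (EOS) $p=p(\rho,e)$,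 assumed to satisfy: if $\rho>0$, then $e>0\Leftrightarrow p(\rho,e)>0$. An example is the ideal-gas EOS $p=(\gamma-1)\rho e$ with adiabatic index $\gamma>1$. The set of admissible states is $$\mathcal G=\Big\{\mathbf U=(\rho,\mathbf m,\mathbf B,E)^\top:\ \rho>0,\ \mathcal E(\mathbf U):=E-\tfrac12\Big(\tfrac{|\mathbf m|^2}{\rho}+|\mathbf B|^2\Big)>0\Big\}.$$ The spectral radius of the Jacobian matrix in the $x_i$-direction is $\mathscr R_i(\mathbf U)=|v_i|+\mathcal C_i$ with $$\mathcal C_i=\frac1{\sqrt2}\Big[\mathcal C_s^2+\frac{|\mathbf B|^2}{\rho}+\sqrt{\Big(\mathcal C_s^2+\frac{|\mathbf B|^2}{\rho}\Big)^2-4\frac{\mathcal C_s^2B_i^2}{\rho}}\,\Big]^{1/2},$$ where $\mathcal C_s=\sqrt{\gamma p/\rho}$ is the sound speed. *)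

(* Defs.v *)
From HB Require Import structures.
From mathcomp Require Import all_boot all_order all_algebra.
From mathcomp Require Import reals.

Set Implicit Arguments.
Unset Strict Implicit.
Unset Printing Implicit Defensive.

Import Order.TTheory GRing.Theory Num.Theory.
Local Open Scope ring_scope.

(* U = (rho, m, B, E) in R^8, split into its blocks of sizes 1, 3, 3, 1, so that
   the library's product of left modules provides U +/- alpha^-1 *: F. *)
Definition state (R : realType) : Type :=
  (R^o * 'rV[R]_3 * 'rV[R]_3 * R^o)%type.

Section MHD.
Variable R : realType.
Implicit Types (U : state R) (u v : 'rV[R]_3) (eos : R -> R -> R) (i : 'I_3).

Definition dot u v : R := \sum_(j < 3) u 0 j * v 0 j.

Definition density U : R := U.1.1.1.
Definition momentum U : 'rV[R]_3 := U.1.1.2.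
Definition magnetic U : 'rV[R]_3 := U.1.2.
Definition total_energy U : R := U.2.

Definition velocity U : 'rV[R]_3 := (density U)^-1 *: momentum U.

(* \mathcal E(U) = rho e *)
Definition internal_energy U : R :=
  total_energy U
  - 2^-1 * (dot (momentum U) (momentum U) / density U
            + dot (magnetic U) (magnetic U)).

Definition specific_internal_energy U : R := internal_energy U / density U.

Definition admissible U : Prop := 0 < density U /\ 0 < internal_energy U.

(* Equation of state p = eos rho e. *)
Definition eos_condition eos : Prop :=
  forall rho e : R, 0 < rho -> (0 < e <-> 0 < eos rho e).

Definition ideal_eos (gamma : R) : R -> R -> R :=
  fun rho e => (gamma - 1) * rho * e.

Lemma ideal_eos_condition (gamma : R) :
  1 < gamma -> eos_condition (ideal_eos gamma).
Proof.
move=> gamma_gt1 rho e rho_gt0.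
by rewrite /ideal_eos pmulr_rgt0 // mulr_gt0 // subr_gt0.
Qed.

Definition pressure eos U : R := eos (density U) (specific_internal_energy U).

Definition total_pressure eos U : R :=
  pressure eos U + dot (magnetic U) (magnetic U) / 2.

Definition flux eos i U : state R :=
  let rho := density U in
  let v := velocity U in
  let B := magnetic U in
  let E := total_energy U in
  let ptot := total_pressure eos U in
  (rho * v 0 i,
   (rho * v 0 i) *: v - B 0 i *: B + ptot *: delta_mx 0 i,
   v 0 i *: B - B 0 i *: v,
   v 0 i * (E + ptot) - B 0 i * dot v B).

Definition sound_speed (gamma : R) eos U : R :=
  Num.sqrt (gamma * pressure eos U / density U).

Definition fast_speed (gamma : R) eos i U : R :=
  let rho := density U in
  let B := magnetic U in
  let Cs := sound_speed gamma eos U in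
  let s := Cs ^+ 2 + dot B B / rho in
  (Num.sqrt 2)^-1
  * Num.sqrt (s + Num.sqrt (s ^+ 2 - 4 * (Cs ^+ 2 * B 0 i ^+ 2 / rho))).

(* Closed form |v_i| + C_i for the spectral radius of the Jacobian of F_i.  The
   adiabatic index gamma enters through C_s = sqrt (gamma p / rho) only; for the
   ideal gas it is the one of ideal_eos. *)
Definition spectral_radius (gamma : R) eos i U : R :=
  `|velocity U 0 i| + fast_speed gamma eos i U.

(* The +/- in the property requires both states to be admissible. *)
Definition LF_splitting (gamma : R) eos i (chi : R) : Prop :=
  forall U, admissible U ->
  forall alpha : R, chi * spectral_radius gamma eos i U <= alpha ->
    admissible (U + alpha^-1 *: flux eos i U) /\
    admissible (U - alpha^-1 *: flux eos i U).

End MHD.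

(* Main.v *)
Require Import Defs.
From mathcomp Require Import all_boot all_order all_algebra.
From mathcomp Require Import reals.
From mathcomp Require Import ring lra.

(** The obstruction is the magnetic term of the energy flux.  Let velocity and
    magnetic field both point along e_i, with components v and b.  Then
    v_i (E + p_tot) - B_i (v . B) loses the whole of the magnetic energy, since
    E + |B|^2/2 - b^2 contains no b, while B itself is not transported at all.
    Moving U by s F_i(U) therefore changes the internal energy to
      (1 + s v) eps + s v b^2/2 - s^2 (p - b^2/2)^2 / (2 rho (1 + s v)),
    where eps is the internal energy of U
    ([internal_energy_aligned_step]).  With - 1 < s v < 0 the last two terms
    are nonpositive, and the middle one is of the size of the magnetic energy as
    soon as |s v| stays away from 0.

    For alpha = 1/|s| of the order of the spectral radius, |s v| does stay away
    from 0 when v = b grows: by [fast_speed_le] the fast speed is at most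
    sqrt (C_s^2 + b^2 / rho), which is of order b, the sound speed being fixed
    by rho and eps.  So at rho = eps = 1 and v = b large, the choice
    alpha = 3 chi b is allowed and gives s v = - 1 / (3 chi), and the magnetic
    loss b^2 / (6 chi) exceeds the internal energy 1.  The pressure enters only
    through the size required of b, so the argument applies to every equation
    of state, without any limit of vanishing pressure. *)

Set Implicit Arguments.
Unset Strict Implicit.
Unset Printing Implicit Defensive.

Import Order.TTheory GRing.Theory Num.Theory.
Local Open Scope ring_scope.

Section FieldAlignedFlow.
Variable R : realType.
Implicit Types (U : state R) (eos : R -> R -> R) (i : 'I_3).

Lemma dot_delta i (a b : R) :
  dot (a *: delta_mx 0 i) (b *: delta_mx 0 i) = a * b.
Proof.
rewrite /dot (bigD1 i) //= big1 => [|j /negPf ji]; rewrite !mxE !eqxx ?ji /=.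
  by rewrite !mulr1 addr0.
by rewrite !mulr0.
Qed.

(** The inner square root is at most s = C_s^2 + |B|^2 / rho, because the
    quantity subtracted from s^2 under it is nonnegative. *)
Lemma fast_speed_le (gamma : R) eos i U : 0 < density U ->
  fast_speed gamma eos i U <=
  Num.sqrt (sound_speed gamma eos U ^+ 2
            + dot (magnetic U) (magnetic U) / density U).
Proof.
move=> rho_gt0; rewrite /fast_speed.
set s := _ + _ / _; set d := 4 * _.
have s_ge0 : 0 <= s.
  rewrite addr_ge0 ?sqr_ge0 // divr_ge0 ?(ltW rho_gt0) //.
  by apply: sumr_ge0 => j _; rewrite -expr2 sqr_ge0.
have d_ge0 : 0 <= d.
  by rewrite mulr_ge0 // divr_ge0 ?(ltW rho_gt0) // mulr_ge0 ?sqr_ge0.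
have inner_le : Num.sqrt (s ^+ 2 - d) <= s.
  rewrite -[leRHS]ger0_norm // -sqrtr_sqr ler_wsqrtr //.
  by rewrite lerBlDr lerDl.
rewrite mulrC ler_pdivrMr ?sqrtr_gt0 // mulrC -sqrtrM //.
by rewrite ler_wsqrtr // mulr2n mulrDl mul1r lerD2l.
Qed.

Lemma sound_speed_sqr_le (gamma : R) eos U : 0 <= gamma -> 0 < density U ->
  sound_speed gamma eos U ^+ 2 <= gamma * `|pressure eos U| / density U.
Proof.
move=> gamma_ge0 rho_gt0; rewrite /sound_speed.
have bound_ge0 : 0 <= gamma * `|pressure eos U| / density U.
  by rewrite divr_ge0 ?mulr_ge0 // ltW.
rewrite -[leRHS]sqr_sqrtr //; apply: lerXn2r; rewrite ?nnegrE ?sqrtr_ge0 //.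
by rewrite ler_wsqrtr // ler_pM2r ?invr_gt0 // ler_wpM2l // ler_norm.
Qed.

Definition aligned_state i (rho v b eps : R) : state R :=
  (rho, (rho * v) *: delta_mx 0 i, b *: delta_mx 0 i,
   eps + (rho * v ^+ 2 + b ^+ 2) / 2).

Lemma internal_energy_aligned i (rho v b eps : R) : rho != 0 ->
  internal_energy (aligned_state i rho v b eps) = eps.
Proof.
move=> rho_neq0.
rewrite /internal_energy /density /momentum /magnetic /total_energy /=.
by rewrite !dot_delta; field.
Qed.

Lemma velocity_aligned i (rho v b eps : R) : rho != 0 ->
  velocity (aligned_state i rho v b eps) = v *: delta_mx 0 i.
Proof.
by move=> rho_neq0; rewrite /velocity /= /momentum /= scalerA mulKf.
Qed.

(** Magnetic induction along e_i vanishes because v is parallel to B, and the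
    Maxwell stress turns the magnetic pressure into the tension - b^2/2. *)
Lemma flux_aligned eos i (rho v b eps : R) : rho != 0 ->
  flux eos i (aligned_state i rho v b eps) =
  (rho * v,
   (rho * v ^+ 2 + eos rho (eps / rho) - b ^+ 2 / 2) *: delta_mx 0 i,
   0,
   v * (rho * v ^+ 2 / 2 + eps + eos rho (eps / rho))).
Proof.
move=> rho_neq0; rewrite /flux velocity_aligned // /total_pressure /pressure.
rewrite /specific_internal_energy internal_energy_aligned //.
rewrite /density /magnetic /total_energy /= !dot_delta !mxE !eqxx !mulr1.
rewrite !scalerA -scalerBl -scalerDl.
congr (_, _, _, _).
- by congr (_ *: _); field.
- by rewrite mulrC -scalerBl subrr scale0r.
- by field.
Qed.

Lemma internal_energy_aligned_step eos i (rho v b eps s : R) :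
  rho != 0 -> 1 + s * v != 0 ->
  let U := aligned_state i rho v b eps in
  internal_energy (U + s *: flux eos i U) =
  (1 + s * v) * eps + s * v * b ^+ 2 / 2
  - s ^+ 2 * (eos rho (eps / rho) - b ^+ 2 / 2) ^+ 2
    / (2 * rho * (1 + s * v)).
Proof.
move=> rho_neq0 sv_neq0 U; rewrite /U flux_aligned //.
rewrite /internal_energy /density /momentum /magnetic /total_energy /=.
rewrite scaler0 addr0 !scalerA -scalerDl !dot_delta.
rewrite /GRing.scale /=.
have -> : rho + s * rho * v = rho * (1 + s * v) by ring.
by field; rewrite rho_neq0 sv_neq0.
Qed.

End FieldAlignedFlow.

Theorem proposition2p5 (R : realType) (gamma : R) (eos : R -> R -> R) (i : 'I_3)
    (hgamma : 1 < gamma) (heos : eos_condition eos) :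
  ~ (exists2 chi : R, 1 <= chi & LF_splitting gamma eos i chi).
Proof.
case=> chi chi_ge1 splitting.
have gamma_ge0 : 0 <= gamma by lra.
(* The summand with the pressure makes b^2 dominate the square of the sound
   speed, the summand 6 chi makes the magnetic loss b^2 / (6 chi) at least 1. *)
pose b : R := 1 + gamma * `|eos 1 1| + 6 * chi.
have gp_ge0 : 0 <= gamma * `|eos 1 1| by rewrite mulr_ge0.
have b_ge1 : 1 <= b by rewrite /b; lra.
have b_le_sqr : b <= b ^+ 2 by rewrite expr2 ler_peMr //; lra.
pose U := aligned_state i 1 b b 1.
have U_adm : admissible U.
  by split; rewrite ?internal_energy_aligned ?oner_neq0 //; exact: ltr01.
have p_eq : pressure eos U = eos 1 1.
  rewrite /pressure /specific_internal_energy internal_energy_aligned //.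
    by rewrite /density /= divr1.
  exact: oner_neq0.
have fast_le : fast_speed gamma eos i U <= 2 * b.
  apply: le_trans (fast_speed_le _ _ _ _) _; first exact: ltr01.
  have -> : 2 * b = Num.sqrt ((2 * b) ^+ 2) by rewrite sqrtr_sqr ger0_norm; lra.
  rewrite ler_wsqrtr //.
  have := sound_speed_sqr_le eos gamma_ge0 (ltr01 : 0 < density U).
  rewrite p_eq /density /magnetic /= dot_delta !divr1 => cs_le.
  rewrite /b in b_le_sqr *; nra.
have radius_le : chi * spectral_radius gamma eos i U <= 3 * chi * b.
  rewrite /spectral_radius velocity_aligned ?oner_neq0 // !mxE !eqxx mulr1.
  rewrite ger0_norm; nra.
have [_ [_]] := splitting U U_adm _ radius_le.
rewrite -scaleNr.
set s := - _.
have sv_eq : s * b = - (3 * chi)^-1.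
  by rewrite /s; field; apply/andP; split; apply/eqP; lra.
have chiV_gt0 : 0 < (3 * chi)^-1 by rewrite invr_gt0; lra.
have chiV_lt1 : (3 * chi)^-1 < 1 by rewrite invf_lt1; lra.
have sv_gt0 : 0 < 1 + s * b by rewrite sv_eq; lra.
rewrite internal_energy_aligned_step ?oner_neq0 ?gt_eqF //.
set loss := _ / (2 * 1 * _).
have loss_ge0 : 0 <= loss.
  apply: divr_ge0; first by rewrite mulr_ge0 ?sqr_ge0.
  by rewrite mulr1; apply: mulr_ge0 => //; apply: ltW.
have magnetic_loss : 2 <= (3 * chi)^-1 * b ^+ 2.
  have -> : 2 = (3 * chi)^-1 * (6 * chi) by field; apply/eqP; lra.
  rewrite ler_pM2l //; apply: le_trans b_le_sqr; rewrite /b; lra.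
rewrite sv_eq; lra.
Qed.
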